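(* Let $k,n$ be positive integers and let $f(z)=f(z_1,\ldots,z_n)$ be a rational $\mathbb{C}^{k\times k}$-valued matrix function of the $n$ complex variables $z=(z_1,\ldots,z_n)$. Then $f$ can be represented as a Schur complement $$f(z)=A(z)/A_{22}(z)=A_{11}(z)-A_{12}(z)A_{22}(z)^{-1}A_{21}(z)$$ of a linear matrix pencil $A(z)=[A_{ij}(z)]_{i,j=1,2}=A_0+z_1A_1+\cdots+z_nA_n$ with $\det A_{22}(z)\not\equiv 0$. Moreover, the following are true: (a) $f(\lambda z)=\lambda f(z)$ (i.e., $f$ is a homogeneous degree-one function) if and only if one can choose $A_0=0$. (b) $f(z)=\overline{f(\overline{z})}$ if and only if one can choose $A_j=\overline{A_j}$ for all $j=0,\ldots,n$. (c) $f(z)=f(z)^T$ if and only if one can choose $A_j=A_j^T$ for all $j=0,\ldots,n$. (d) $f(z)=f(\overline{z})^*$ if and only if one can choose $A_j=A_j^*$ for all $j=0,\ldots,n$. (e) For any combination of the properties (a)-(d): $f$ satisfies simultaneously all the functional relations in that combination if and only if one can choose the matrices $A_j$ to have simultaneously all the associated properties.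
   Context: A linear matrix pencil is a function $A(z)=A_0+z_1A_1+\cdots+z_nA_n$ with $A_0,\ldots,A_n\in\mathbb{C}^{m\times m}$ for some $m$. It is written in $2\times2$ block form $A(z)=[A_{ij}(z)]_{i,j=1,2}$ when all $A_j$ are partitioned conformally (independently of $z$) as $2\times 2$ block matrices with square diagonal blocks; here the $(1,1)$-block is $k\times k$. The condition $\det A_{22}(z)\not\equiv0$ means that $\det A_{22}$ is not identically zero. Equalities between functions of $z$ are equalities of rational functions. ''One can choose'' means that there exists a representation $f(z)=A(z)/A_{22}(z)$ by a linear matrix pencil with $\det A_{22}(z)\not\equiv 0$ whose coefficient matrices have the indicated property. Convention: in this theorem, a linear matrix pencil $A(z)=A_{11}(z)$ is regarded as a degenerate case of a Schur complement, $A(z)=A(z)/A_{22}(z)$ with $A_{22}(z)$ a $0\times0$ matrix, in which case the condition $\det A_{22}(z)\not\equiv0$ is ignored. $\overline{A}$, $A^T$, $A^*=\overline{A}^T$ denote entrywise conjugate, transpose and conjugate transpose, and $\overline{z}=(\overline{z_1},\ldots,\overline{z_n})$. *)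

(* Defs.v *)
(* The definitions are for any numClosedFieldType C; the complex numbers are
   R[i] with R : realType. *)
From HB Require Import structures.
From mathcomp Require Import all_boot all_order all_algebra.
From mathcomp Require Import fraction complex reals mpoly.

Set Implicit Arguments.
Unset Strict Implicit.
Unset Printing Implicit Defensive.

Import GRing.Theory Num.Theory.
Local Open Scope ring_scope.

Notation ratfun C n := {fraction {mpoly C[n]}}.

(* The rational function f is regular at z, with value v: some fraction
   representing f has a denominator that does not vanish at z. *)
Definition value_at (C : numClosedFieldType) (n : nat)
    (f : ratfun C n) (z : 'I_n -> C) (v : C) : Prop :=
  exists p q : {mpoly C[n]},
    [/\ q.@[z] != 0, f = tofrac p / tofrac q & v = p.@[z] / q.@[z]].

Lemma value_at_uniq (C : numClosedFieldType) (n : nat)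
    (f : ratfun C n) (z : 'I_n -> C) (v w : C) :
  value_at f z v -> value_at f z w -> v = w.
Proof.
move=> [p [q [qz -> ->]]] [p' [q' [qz' e ->]]].
have nz (r : {mpoly C[n]}) : r.@[z] != 0 -> tofrac r != 0.
  by move=> rz; rewrite tofrac_eq0; apply: contraNneq rz => ->; rewrite meval0.
apply/eqP; rewrite eqr_div // -!mevalM; apply/eqP; congr (_.@[z]).
apply/eqP; rewrite -tofrac_eq !tofracM -eqr_div ?nz //; exact/eqP.
Qed.

Definition mxvalue_at (C : numClosedFieldType) (n k : nat)
    (f : 'M[ratfun C n]_k) (z : 'I_n -> C) (V : 'M[C]_k) : Prop :=
  forall i j, value_at (f i j) z (V i j).

(* A functional relation between f at z and f at another point depending on z
   is an equality of rational functions of z: it is required at all z for which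
   both values are defined. *)

(* f(lambda z) = lambda f(z) *)
Definition homogeneous_deg1 (C : numClosedFieldType) (n k : nat)
    (f : 'M[ratfun C n]_k) : Prop :=
  forall (lambda : C) (z : 'I_n -> C) (V W : 'M[C]_k),
    mxvalue_at f (fun i => lambda * z i) V -> mxvalue_at f z W ->
    V = lambda *: W.

Definition conj_mx (C : numClosedFieldType) (m n : nat)
    (A : 'M[C]_(m, n)) : 'M[C]_(m, n) := map_mx Num.conj A.

Definition adjoint_mx (C : numClosedFieldType) (m n : nat)
    (A : 'M[C]_(m, n)) : 'M[C]_(n, m) := (conj_mx A)^T.

(* f(z) = conj (f(conj z)) *)
Definition conj_invariant (C : numClosedFieldType) (n k : nat)
    (f : 'M[ratfun C n]_k) : Prop :=
  forall (z : 'I_n -> C) (V W : 'M[C]_k),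
    mxvalue_at f z V -> mxvalue_at f (fun i => (z i)^*) W -> V = conj_mx W.

(* f(z) = f(conj z)^* *)
Definition adjoint_invariant (C : numClosedFieldType) (n k : nat)
    (f : 'M[ratfun C n]_k) : Prop :=
  forall (z : 'I_n -> C) (V W : 'M[C]_k),
    mxvalue_at f z V -> mxvalue_at f (fun i => (z i)^*) W -> V = adjoint_mx W.

(* A_0 is A ord0, and A_j, for 1 <= j <= n, is A (lift ord0 i) with i = j - 1
   the index of the variable z_j. *)
Definition pencil (C : numClosedFieldType) (n N : nat)
    (A : 'I_n.+1 -> 'M[C]_N) : 'M[ratfun C n]_N :=
  map_mx (@tofrac {mpoly C[n]})
    (map_mx (@mpolyC n C) (A ord0)
     + \sum_(i < n) 'X_i *: map_mx (@mpolyC n C) (A (lift ord0 i))).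

Definition schur_complement (F : fieldType) (k m : nat) (M : 'M[F]_(k + m)) :
    'M[F]_k :=
  ulsubmx M - ursubmx M *m invmx (drsubmx M) *m dlsubmx M.

(* For m = 0 this says that f is the pencil itself: the determinant of the
   0 x 0 matrix is 1, so the first condition holds automatically. *)
Definition schur_rep (C : numClosedFieldType) (n k m : nat)
    (f : 'M[ratfun C n]_k) (A : 'I_n.+1 -> 'M[C]_(k + m)) : Prop :=
  \det (drsubmx (pencil A)) != 0 /\ f = schur_complement (pencil A).

(* Main.v *)
Require Import Defs.
From HB Require Import structures.
From mathcomp Require Import all_boot all_order all_algebra.
From mathcomp Require Import fraction complex reals mpoly.

Set Implicit Arguments.
Unset Strict Implicit.
Unset Printing Implicit Defensive.

Import GRing.Theory Num.Theory.
Local Open Scope ring_scope.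

(* Rational functions of z are closed under u D^-1 v with u, v constant and D a
   linear pencil: sums and products of such expressions, and the inverse of a
   scalar one, are block matrices of the same kind, so every f has a Schur
   complement representation.  If f is homogeneous, then
   f(z) = (z_l / c) f((c / z_l) z), and on the hyperplane z_l = c the constant
   coefficient can be merged with that of z_l.  If f is symmetric (real,
   Hermitian), then the transposed (conjugate, adjoint) pencil also represents f;
   the average of the two Schur complements is the Schur complement of a doubled
   pencil, which becomes symmetric (real, Hermitian) after a change of basis
   of its auxiliary space.  Two of the three symmetries imply the third, and the
   real construction keeps a symmetric pencil symmetric, so combinations are
   obtained by performing the constructions one after the other.

   All identities are checked at generic points z. *)

(** * Generic points and values of rational functions *)

(** Singles out the last variable, so that induction on the number of variables can treat [p] as a
    univariate polynomial whose coefficients have one variable fewer. *)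
Lemma meval_muni (C : comNzRingType) (n : nat) (p : {mpoly C[n.+1]})
    (z : 'I_n -> C) (t : C) :
  p.@[fun i => oapp z t (unlift ord_max i)] = (map_poly (meval z) (muni p)).[t].
Proof.
rewrite mevalE muniE rmorph_sum horner_sum; apply: eq_bigr => m _.
rewrite big_ord_recr /= unlift_none /= map_polyZ map_polyXn hornerZ hornerXn.
rewrite [mpoly_meval__canonical__GRing_RMorphism z _]/= mevalZ mevalX mulrA.
congr (_ * _ * _).
apply: eq_bigr => i _; rewrite mnmE.
have -> : widen_ord (leqnSn n) i = lift ord_max i by apply/ord_inj; rewrite lift_max.
by rewrite liftK /=.
Qed.

Lemma muni_eq0 (C : nzRingType) (n : nat) (p : {mpoly C[n.+1]}) : muni p = 0 -> p = 0.
Proof.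
move=> p0; apply/mpolyP => m; rewrite mcoeff0.
pose w (m : 'X_{1..n.+1}) : 'X_{1..n} := [multinom (m (widen_ord (leqnSn n) i)) | i < n].
have : ((muni p)`_(m ord_max))@_(w m) = 0 by rewrite p0 coef0 mcoeff0.
rewrite muniE coef_sum raddf_sum /=.
(* A monomial is determined by its first [n] exponents and its last one, so a single term survives
   in the sum. *)
have wE (m' : 'X_{1..n.+1}) : (w m' == w m) && (m ord_max == m' ord_max) = (m' == m).
  apply/andP/eqP => [[/eqP/mnmP wm /eqP mm]|-> //].
  apply/mnmP => i; case: (unliftP ord_max i) => [j ->|-> //].
  have := wm j; rewrite !mnmE (_ : widen_ord _ j = lift ord_max j) //.
  by apply/ord_inj; rewrite lift_max.
under eq_bigr => m' _.
  rewrite coefZ coefXn mulr_natr raddfMn /= mcoeffZ mcoeffX mulr_natr -mulrnA mulnb wE.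
  over.
case: (boolP (m \in msupp p)) => [mp|]; last by move/memN_msupp_eq0.
rewrite (bigD1_seq m) ?msupp_uniq //= eqxx big1 => [|m' /negPf -> //].
by rewrite addr0.
Qed.

(** By induction, the leading coefficient in the last variable is nonzero at some point.
    Specializing there leaves a nonzero univariate polynomial, which has a nonroot because a closed
    field is infinite. *)
Lemma meval_neq0 (C : closedFieldType) (n : nat) (p : {mpoly C[n]}) :
  p != 0 -> exists z, p.@[z] != 0.
Proof.
elim: n p => [|n IHn] p p0.
  exists (fun=> 0); apply: contraNneq p0 => pz; apply/eqP/mpolyP => m.
  rewrite mcoeff0 -pz mevalE.
  (* Without variables there is only one monomial, and its coefficient is the value. *)
  have m0 (m' : 'X_{1..0}) : m' = m by apply/mnmP; case.
  under eq_bigr => m' _ do rewrite big_ord0 mulr1.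
  case: (boolP (m \in msupp p)) => [mp|mp]; last first.
    rewrite memN_msupp_eq0 // big_seq big1 // => m'.
    by rewrite (m0 m') (negPf mp).
  rewrite (bigD1_seq m) ?msupp_uniq //= big1 ?addr0 // => m'.
  by rewrite (m0 m') eqxx.
have q0 : muni p != 0 by apply: contraNneq p0 => /muni_eq0 ->.
have /IHn[z qz] : lead_coef (muni p) != 0 by rewrite lead_coef_eq0.
have : map_poly (meval z) (muni p) != 0.
  apply: contraNneq qz => /polyP/(_ (size (muni p)).-1).
  by rewrite coef_map coef0 /= lead_coefE => ->.
case/closed_nonrootP => t; rewrite rootE -meval_muni => ptz.
by eexists; apply: ptz.
Qed.

Lemma fraction_ratio (R : idomainType) (x : {fraction R}) :
  exists p q : R, q != 0 /\ x = tofrac p / tofrac q.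
Proof.
elim/quotW: x => r; exists (frac r).1, (frac r).2; split; first exact: denom_ratioP.
have d0 : tofrac (frac r).2 != 0 by rewrite tofrac_eq0 denom_ratioP.
(* Multiplication is exposed as the operation on the quotient of ratios, so that the equality
   becomes an equivalence of two ratios, that is, a cross-multiplication. *)
apply: (mulIf d0); rewrite divfK // -[LHS]/(FracField.mul _ _).
unlock FracField.tofrac; rewrite -FracField.pi_mul; apply/eqmodP => /=.
rewrite FracField.equivfE /FracField.mulf.
rewrite !numden_Ratio ?mulf_neq0 ?denom_ratioP ?oner_neq0 //.
by rewrite !mulr1 mulrC.
Qed.

Section Generic.

Variables (C : numClosedFieldType) (n : nat).
Implicit Types (z : 'I_n -> C) (P Q : ('I_n -> C) -> Prop) (p q : {mpoly C[n]}).
Implicit Types (f g : ratfun C n).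

(** [P] holds on a nonempty Zariski open set. Such properties are closed under finite conjunction
    and always have a witness. *)
Definition generic P := exists2 r : {mpoly C[n]}, r != 0 & forall z, r.@[z] != 0 -> P z.

Lemma generic_imp P Q : (forall z, P z -> Q z) -> generic P -> generic Q.
Proof. by move=> PQ [r r0 rP]; exists r => // z /rP/PQ. Qed.

Lemma generic_and P Q :
  generic P -> generic Q -> generic (fun z => P z /\ Q z).
Proof.
move=> [r r0 rP] [s s0 sQ]; exists (r * s); first by rewrite mulf_neq0.
by move=> z; rewrite mevalM mulf_eq0 => /norP[/rP ? /sQ ?].
Qed.

Lemma generic_all (k : nat) (P : 'I_k -> ('I_n -> C) -> Prop) :
  (forall i, generic (P i)) -> generic (fun z => forall i, P i z).
Proof.
move=> gP; have /fin_all_exists[r rP] i : exists r : {mpoly C[n]},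
    r != 0 /\ forall z, r.@[z] != 0 -> P i z by have [r ? ?] := gP i; exists r.
exists (\prod_i r i); first by apply/prodf_neq0 => i _; case: (rP i).
by move=> z; rewrite rmorph_prod => /prodf_neq0 rz i; case: (rP i) => _; apply; apply: rz.
Qed.

Lemma generic_meval p : p != 0 -> generic (fun z => p.@[z] != 0).
Proof. by move=> p0; exists p. Qed.

Lemma generic_ex P : generic P -> exists z, P z.
Proof. by case=> r /meval_neq0[z rz] rP; exists z; apply: rP. Qed.

(** Otherwise [p] would be generically nonzero, and some point would satisfy both conditions. *)
Lemma generic_meval_eq0 p : generic (fun z => p.@[z] = 0) -> p = 0.
Proof.
move=> gp; apply/eqP/negPn/negP => /generic_meval/(generic_and gp)/generic_ex[z].
by case=> ->; rewrite eqxx.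
Qed.

Lemma tofrac_meval_neq0 p z : p.@[z] != 0 -> tofrac p != 0.
Proof. by move=> pz; rewrite tofrac_eq0; apply: contraNneq pz => ->; rewrite meval0. Qed.

Lemma value_at_tofrac p z : value_at (tofrac p) z p.@[z].
Proof. by exists p, 1; split; rewrite ?meval1 ?oner_eq0 // ?tofrac1 ?divr1. Qed.

Lemma value_atD f g z v w :
  value_at f z v -> value_at g z w -> value_at (f + g) z (v + w).
Proof.
move=> [p [q [qz -> ->]]] [p' [q' [qz' -> ->]]].
exists (p * q' + p' * q), (q * q'); split; first by rewrite mevalM mulf_neq0.
  by rewrite tofracD !tofracM addf_div ?(tofrac_meval_neq0 qz) ?(tofrac_meval_neq0 qz').
by rewrite mevalD !mevalM addf_div.
Qed.

Lemma value_atM f g z v w :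
  value_at f z v -> value_at g z w -> value_at (f * g) z (v * w).
Proof.
move=> [p [q [qz -> ->]]] [p' [q' [qz' -> ->]]].
exists (p * p'), (q * q'); split; first by rewrite mevalM mulf_neq0.
  by rewrite !tofracM mulf_div.
by rewrite !mevalM mulf_div.
Qed.

Lemma value_atN f z v : value_at f z v -> value_at (- f) z (- v).
Proof.
move=> [p [q [qz -> ->]]]; exists (- p), q.
by split; rewrite ?mevalN ?tofracN ?mulNr.
Qed.

Lemma value_atV f z v : v != 0 -> value_at f z v -> value_at f^-1 z v^-1.
Proof.
move=> v0 [p [q [qz -> vE]]]; exists q, p.
split; rewrite ?vE ?invf_div //; apply: contraNneq v0 => pz.
by rewrite vE pz mul0r.
Qed.

Lemma value_at_sum (I : Type) (s : seq I) (B : pred I) (F : I -> ratfun C n)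
    (V : I -> C) z :
  (forall i, value_at (F i) z (V i)) ->
  value_at (\sum_(i <- s | B i) F i) z (\sum_(i <- s | B i) V i).
Proof.
move=> FV; apply: (big_rec2 (fun f v => value_at f z v)) => [|i v f _ ?].
  by rewrite -tofrac0 -(meval0 z); apply: value_at_tofrac.
exact: value_atD.
Qed.

Lemma value_at_prod (I : Type) (s : seq I) (B : pred I) (F : I -> ratfun C n)
    (V : I -> C) z :
  (forall i, value_at (F i) z (V i)) ->
  value_at (\prod_(i <- s | B i) F i) z (\prod_(i <- s | B i) V i).
Proof.
move=> FV; apply: (big_rec2 (fun f v => value_at f z v)) => [|i v f _ ?].
  by rewrite -tofrac1 -(meval1 z); apply: value_at_tofrac.
exact: value_atM.
Qed.

Lemma value_at_ext f z z' v : z =1 z' -> value_at f z v -> value_at f z' v.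
Proof.
move=> zz' [p [q [qz -> ->]]]; exists p, q.
by split; rewrite -?(meval_eq _ zz').
Qed.

Lemma generic_value_at f : generic (fun z => exists v, value_at f z v).
Proof.
have [p [q [q0 ->]]] := fraction_ratio f; exists q => // z qz.
by exists (p.@[z] / q.@[z]); exists p, q.
Qed.

(** Complex conjugation of the point is not polynomial, but becomes so once the value is conjugated
    as well. The same format covers dilations, with [rho] the identity. *)
Definition twist (rho : C -> C) (tau : ('I_n -> C) -> 'I_n -> C) :=
  forall p, exists2 q, (forall z, q.@[z] = rho p.@[tau z]) & p != 0 -> q != 0.

Lemma twist_conj : twist Num.conj (fun z i => (z i)^*).
Proof.
move=> p; pose q := map_mpoly Num.conj p.
have qE z : q.@[z] = (p.@[fun i => (z i)^*])^*.
  rewrite [in RHS]mevalE /q /map_mpoly /mmap !rmorph_sum; apply: eq_bigr => m _.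
  rewrite [LHS]mevalM mevalC mmap1_id mevalX rmorphM rmorph_prod; congr (_ * _).
  by apply: eq_bigr => i _; rewrite rmorphXn /= conjCK.
exists q => // /meval_neq0[z pz]; apply: contraNneq pz => q0.
have := qE (fun i => (z i)^*); rewrite q0 meval0 => /esym/eqP.
rewrite conjC_eq0 => /eqP <-; apply/eqP/meval_eq => i.
by rewrite conjCK.
Qed.

Lemma twist_scale (a : C) : a != 0 -> twist id (fun z i => a * z i).
Proof.
move=> a0 p; pose q := p \mPo [tuple a *: 'X_i | i < n].
have qE z : q.@[z] = p.@[fun i => a * z i].
  rewrite comp_mpoly_meval; apply: meval_eq => i.
  by rewrite tnth_mktuple mevalZ mevalXU.
exists q => // /meval_neq0[z pz]; apply: contraNneq pz => q0.
have := qE (fun i => a^-1 * z i); rewrite q0 meval0 => ->.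
by apply/eqP/meval_eq => i; rewrite mulVKf.
Qed.

Lemma generic_twist (rho : {rmorphism C -> C}) tau P :
  twist rho tau -> generic P -> generic (fun z => P (tau z)).
Proof.
move=> tw [r r0 rP]; have [q qE /(_ r0) q0] := tw r.
by exists q => // z; rewrite qE fmorph_eq0 => /rP.
Qed.

(** Extends a functional relation from generic points to every point where both sides are defined:
    after clearing denominators it is a polynomial identity. *)
Lemma value_at_twist (rho : {rmorphism C -> C}) tau a f g z v w :
  twist rho tau ->
  generic (fun x => exists v w,
    [/\ value_at f x v, value_at g (tau x) w & v = a * rho w]) ->
  value_at f z v -> value_at g (tau z) w -> v = a * rho w.
Proof.
move=> tw gfg [p [q [qz fE ->]]] [p' [q' [qz' gE ->]]].
have [P' P'E _] := tw p'; have [Q' Q'E _] := tw q'.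
have Q'z : Q'.@[z] != 0 by rewrite Q'E fmorph_eq0.
have q0 : q != 0 by apply: contraNneq qz => ->; rewrite meval0.
have Q'0 : Q' != 0 by apply: contraNneq Q'z => ->; rewrite meval0.
have key x : Q'.@[x] != 0 -> q.@[x] != 0 ->
    p.@[x] / q.@[x] = a * rho (p'.@[tau x] / q'.@[tau x]) <->
    (p * Q' - a *: (q * P')).@[x] = 0.
  move=> Q'x qx; rewrite fmorph_div /= -P'E -Q'E mevalB mevalZ !mevalM.
  rewrite mulrA mulrCA; split=> [/eqP|/eqP].
    by rewrite eqr_div // => /eqP ->; rewrite mulrC subrr.
  by rewrite subr_eq0 => pQ; apply/eqP; rewrite eqr_div // (eqP pQ) mulrC.
(* The cleared polynomial vanishes at generic points, hence identically, and in particular at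
   [z]. *)
apply/key => //; rewrite (generic_meval_eq0 (p := p * Q' - _)) ?meval0 //.
have := generic_and (generic_and (generic_meval q0) (generic_meval Q'0)) gfg.
apply: generic_imp => x [[qx Q'x] [b [c [fb gc bc]]]].
apply/key => //.
have fx : value_at f x (p.@[x] / q.@[x]) by exists p, q.
have gx : value_at g (tau x) (p'.@[tau x] / q'.@[tau x]).
  by exists p', q'; split=> //; move: Q'x; rewrite Q'E fmorph_eq0.
by rewrite (value_at_uniq fx fb) (value_at_uniq gx gc).
Qed.

End Generic.

(** * Schur complements of pencils *)

Section SchurComplement.

Variables (F : fieldType) (k m : nat).
Implicit Type M : 'M[F]_(k + m).

Lemma schur_complement_map (rF : fieldType) (phi : {rmorphism F -> rF}) M :
  schur_complement (map_mx phi M) = map_mx phi (schur_complement M).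
Proof.
by rewrite /schur_complement map_mxB !map_mxM map_invmx -map_ulsubmx
  -map_ursubmx -map_dlsubmx -map_drsubmx.
Qed.

Lemma schur_complement_tr M : schur_complement M^T = (schur_complement M)^T.
Proof.
rewrite /schur_complement [RHS]linearB /= !trmx_mul trmx_inv mulmxA.
by rewrite trmx_ulsub trmx_ursub trmx_dlsub trmx_drsub.
Qed.

(** In the product term the blocks contribute [a], [a^-1] and [a], so it scales by [a] like the
    first term. *)
Lemma schur_complementZ (a : F) M : \det (drsubmx M) != 0 -> a != 0 ->
  schur_complement (a *: M) = a *: schur_complement M.
Proof.
move=> M0 a0; have aM : drsubmx M \in unitmx by rewrite unitmxE unitfE.
have [ul ur dl dr] : [/\ ulsubmx (a *: M) = a *: ulsubmx M,
    ursubmx (a *: M) = a *: ursubmx M, dlsubmx (a *: M) = a *: dlsubmx M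
  & drsubmx (a *: M) = a *: drsubmx M].
  by split; apply/matrixP => i j; rewrite !mxE.
rewrite /schur_complement ul ur dl dr.
rewrite invmxZ ?unitmxZ ?unitfE // scalerBr -!(scalemxAl, scalemxAr) !scalerA.
by rewrite divff // mulr1.
Qed.

End SchurComplement.

(** * Values of pencils and of their Schur complements *)

Section Pencil.

Variables (C : numClosedFieldType) (n : nat).
Implicit Types (z : 'I_n -> C).

Definition pencil_at (N : nat) (A : 'I_n.+1 -> 'M[C]_N) z : 'M[C]_N :=
  A ord0 + \sum_(i < n) z i *: A (lift ord0 i).

Lemma map_meval_pencil (N : nat) (A : 'I_n.+1 -> 'M[C]_N) z :
  map_mx (meval z) (map_mx (@mpolyC n C) (A ord0)
    + \sum_(i < n) 'X_i *: map_mx (@mpolyC n C) (A (lift ord0 i)))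
  = pencil_at A z.
Proof.
apply/matrixP => i j; rewrite !mxE !summxE [LHS]mevalD mevalC; congr (_ + _).
rewrite [LHS]raddf_sum; apply: eq_bigr => l _.
by rewrite !mxE [LHS]mevalM mevalXU mevalC.
Qed.

Lemma value_at_pencil (N : nat) (A : 'I_n.+1 -> 'M[C]_N) z :
  mxvalue_at (pencil A) z (pencil_at A z).
Proof.
move=> i j; rewrite -map_meval_pencil [X in value_at X]mxE.
by rewrite [X in value_at _ _ X]mxE; apply: value_at_tofrac.
Qed.

Lemma value_at_sign (b : nat) z :
  value_at ((-1) ^+ b : ratfun C n) z ((-1) ^+ b).
Proof.
have -> : (-1) ^+ b = tofrac ((-1) ^+ b) :> ratfun C n.
  by rewrite tofracXn tofracN tofrac1.
have -> : (-1) ^+ b = ((-1) ^+ b : {mpoly C[n]}).@[z] :> C.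
  by rewrite rmorphXn /= mevalN meval1.
exact: value_at_tofrac.
Qed.

Lemma value_at_det (N : nat) (M : 'M[ratfun C n]_N) z (V : 'M[C]_N) :
  mxvalue_at M z V -> value_at (\det M) z (\det V).
Proof.
move=> MV; apply: value_at_sum => s; apply: value_atM; last first.
  by apply: value_at_prod => i; apply: MV.
exact: value_at_sign.
Qed.

Lemma value_at_mulmx (a b c : nat) (M : 'M[ratfun C n]_(a, b))
    (N : 'M[ratfun C n]_(b, c)) z (V : 'M[C]_(a, b)) (W : 'M[C]_(b, c)) :
  (forall i j, value_at (M i j) z (V i j)) ->
  (forall i j, value_at (N i j) z (W i j)) ->
  forall i j, value_at ((M *m N) i j) z ((V *m W) i j).
Proof.
by move=> MV NW i j; rewrite !mxE; apply: value_at_sum => l; apply: value_atM.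
Qed.

Lemma value_at_neq0 (f : ratfun C n) z v : value_at f z v -> v != 0 -> f != 0.
Proof.
move=> fv; apply: contraNneq => f0; move: fv; rewrite f0 => fv.
by rewrite (value_at_uniq fv (w := 0)) // -(meval0 z) -tofrac0; apply: value_at_tofrac.
Qed.

(** The adjugate formula writes the entries of the inverse through determinants, whose values are
    known. *)
Lemma value_at_invmx (N : nat) (M : 'M[ratfun C n]_N) z (V : 'M[C]_N) :
  \det V != 0 -> mxvalue_at M z V -> mxvalue_at (invmx M) z (invmx V).
Proof.
move=> V0 MV; have dMV := value_at_det MV.
rewrite /invmx !unitmxE !unitfE V0 (value_at_neq0 dMV V0) => i j.
rewrite !mxE; apply: value_atM; first exact: value_atV.
rewrite /cofactor; apply: value_atM; last first.
  by apply: value_at_det => i' j'; rewrite !mxE; apply: MV.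
exact: value_at_sign.
Qed.

Lemma value_at_schur (k m : nat) (M : 'M[ratfun C n]_(k + m)) z V :
  \det (drsubmx V) != 0 -> mxvalue_at M z V ->
  mxvalue_at (schur_complement M) z (schur_complement V).
Proof.
move=> V0 MV i j; rewrite [X in value_at X]mxE [X in value_at _ _ X]mxE.
apply: value_atD; first by rewrite !mxE.
rewrite mxE [X in value_at _ _ X]mxE.
apply/value_atN/value_at_mulmx => [i' j'|i' j']; last by rewrite !mxE.
apply: value_at_mulmx => [??|]; first by rewrite !mxE.
by apply: value_at_invmx => // ??; rewrite !mxE.
Qed.

Lemma generic_pencil_det (k m : nat) (A : 'I_n.+1 -> 'M[C]_(k + m)) :
  \det (drsubmx (pencil A)) != 0 ->
  generic (fun z => \det (drsubmx (pencil_at A z)) != 0).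
Proof.
rewrite /pencil -map_drsubmx det_map_mx tofrac_eq0 => /generic_meval.
apply: generic_imp => z.
by rewrite -[_.@[z]]/(meval z _) -det_map_mx map_drsubmx map_meval_pencil.
Qed.

Lemma pencil_det_neq0 (k m : nat) (A : 'I_n.+1 -> 'M[C]_(k + m)) z :
  \det (drsubmx (pencil_at A z)) != 0 -> \det (drsubmx (pencil A)) != 0.
Proof.
apply: value_at_neq0; apply: value_at_det.
have := value_at_pencil A z; move: (pencil A) (pencil_at A z) => M V MV i j.
by rewrite !mxE.
Qed.

(** The numerator of each entry of the difference vanishes at generic points, hence is zero. *)
Lemma mx_eq_generic (k : nat) (f g : 'M[ratfun C n]_k) :
  generic (fun z => exists V, mxvalue_at f z V /\ mxvalue_at g z V) -> f = g.
Proof.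
move=> fg; apply/matrixP => i j; apply/eqP; rewrite -subr_eq0.
have [p [q [q0 e]]] := fraction_ratio (f i j - g i j).
rewrite e (generic_meval_eq0 (p := p)) ?tofrac0 ?mul0r //.
apply: generic_imp (generic_and (generic_meval q0) fg) => z [qz [V [fV gV]]].
have e0 : value_at (f i j - g i j) z 0.
  by rewrite -(subrr (V i j)); apply: value_atD => //; apply: value_atN.
have /value_at_uniq/(_ e0)/eqP : value_at (f i j - g i j) z (p.@[z] / q.@[z]).
  by exists p, q.
by rewrite mulf_eq0 invr_eq0 (negPf qz) orbF => /eqP.
Qed.

Lemma generic_mxvalue (k : nat) (f : 'M[ratfun C n]_k) :
  generic (fun z => exists V, mxvalue_at f z V).
Proof.
have : generic (fun z => forall i j, exists v, value_at (f i j) z v).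
  apply: (@generic_all _ _ _
    (fun i z => forall j, exists v, value_at (f i j) z v)) => i.
  apply: (@generic_all _ _ _ (fun j z => exists v, value_at (f i j) z v)) => j.
  exact: generic_value_at.
apply: generic_imp => z fz.
have [V VP] : exists V : 'I_k -> 'I_k -> C, forall i j, value_at (f i j) z (V i j).
  apply: (@fin_all_exists _ _ (fun i v => forall j, value_at (f i j) z (v j))) => i.
    by apply: (@fin_all_exists _ _ (fun j v => value_at (f i j) z v)) => j; apply: fz.
by exists (\matrix_(i, j) V i j) => i j; rewrite mxE.
Qed.

Lemma mxvalue_at_uniq (k : nat) (f : 'M[ratfun C n]_k) z V W :
  mxvalue_at f z V -> mxvalue_at f z W -> V = W.
Proof. by move=> fV fW; apply/matrixP => i j; apply: value_at_uniq (fV i j) (fW i j). Qed.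

(** Reduces the later checks of representations to identities between matrices over [C] at generic
    points. *)
Lemma schur_repP (k m : nat) f (A : 'I_n.+1 -> 'M[C]_(k + m)) :
  schur_rep f A <->
  generic (fun z => \det (drsubmx (pencil_at A z)) != 0 /\
                    mxvalue_at f z (schur_complement (pencil_at A z))).
Proof.
split=> [[A0 ->]|gA].
  apply: generic_imp (generic_pencil_det A0) => z Az; split=> //.
  by apply: value_at_schur => //; apply: value_at_pencil.
split; first by have [z [/pencil_det_neq0]] := generic_ex gA.
apply: mx_eq_generic; apply: generic_imp gA => z [Az fz].
by eexists; split; first exact: fz; apply: value_at_schur => //; apply: value_at_pencil.
Qed.

Lemma schur_rep_value (k m : nat) f (A : 'I_n.+1 -> 'M[C]_(k + m)) z :
  schur_rep f A -> \det (drsubmx (pencil_at A z)) != 0 ->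
  mxvalue_at f z (schur_complement (pencil_at A z)).
Proof.
by move=> [_ ->] Az; apply: value_at_schur => //; apply: value_at_pencil.
Qed.

Lemma pencil_at_conj (N : nat) (A : 'I_n.+1 -> 'M[C]_N) z :
  pencil_at (fun j => conj_mx (A j)) z =
  conj_mx (pencil_at A (fun i => (z i)^*)).
Proof.
rewrite /conj_mx /pencil_at map_mxD map_mx_sum; congr (_ + _).
by apply: eq_bigr => i _; rewrite map_mxZ /= conjCK.
Qed.

Lemma pencil_at_tr (N : nat) (A : 'I_n.+1 -> 'M[C]_N) z :
  pencil_at (fun j => (A j)^T) z = (pencil_at A z)^T.
Proof.
rewrite /pencil_at [RHS]linearD linear_sum; congr (_ + _).
by apply: eq_bigr => i _; rewrite linearZ.
Qed.

Lemma pencil_at_ext (N : nat) (A B : 'I_n.+1 -> 'M[C]_N) z :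
  A =1 B -> pencil_at A z = pencil_at B z.
Proof.
move=> AB; rewrite /pencil_at AB; congr (_ + _).
by apply: eq_bigr => i _; rewrite AB.
Qed.

End Pencil.

(** * Existence of a representation *)

Section Realization.

Variables (C : numClosedFieldType) (n : nat).
Local Notation K := (ratfun C n).

Definition affine (x : K) := exists a : 'I_n.+1 -> C,
  x = tofrac (mpolyC n (a ord0) + \sum_(i < n) 'X_i * mpolyC n (a (lift ord0 i))).

Definition affine_mx (a b : nat) (M : 'M[K]_(a, b)) := forall i j, affine (M i j).

Definition constf : C -> K := @tofrac {mpoly C[n]} \o @mpolyC n C.

HB.instance Definition _ := GRing.RMorphism.on constf.

Lemma affineN x : affine x -> affine (- x).
Proof.
move=> [a ->]; exists (fun j => - a j); rewrite -tofracN opprD raddfN -sumrN.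
by congr (tofrac (_ + _)); apply: eq_bigr => i _; rewrite raddfN mulrN.
Qed.

Lemma affine_const c : affine (constf c).
Proof.
exists (fun j => if j == ord0 then c else 0); rewrite eqxx /= big1 ?addr0 // => i _.
by rewrite raddf0 mulr0.
Qed.

Lemma affine0 : affine 0.
Proof. by rewrite -(rmorph0 constf); apply: affine_const. Qed.

Lemma affineX (i : 'I_n) : affine (tofrac 'X_i).
Proof.
exists (fun j => (j == lift ord0 i)%:R); rewrite raddf0 add0r (bigD1 i) //=.
rewrite eqxx big1 ?addr0 => [|l /negPf li]; first by rewrite mpolyC1 mulr1.
by rewrite (inj_eq lift_inj) li raddf0 mulr0.
Qed.

Lemma affine_block (a b c d : nat) (M : 'M[K]_(a, b)) (N : 'M_(a, c))
    (P : 'M_(d, b)) (Q : 'M_(d, c)) :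
  affine_mx M -> affine_mx N -> affine_mx P -> affine_mx Q ->
  affine_mx (block_mx M N P Q).
Proof.
move=> aM aN aP aQ i j; rewrite !mxE; case: splitP => i' _.
  by rewrite !mxE; case: splitP => j' _.
by rewrite !mxE; case: splitP => j' _.
Qed.

Lemma affine_constmx (a b : nat) (M : 'M[C]_(a, b)) : affine_mx (map_mx constf M).
Proof. by move=> i j; rewrite mxE; apply: affine_const. Qed.

Lemma affine_mx0 (a b : nat) : affine_mx (0 : 'M[K]_(a, b)).
Proof. by move=> i j; rewrite mxE; apply: affine0. Qed.

Lemma affine_mxN (a b : nat) (M : 'M[K]_(a, b)) : affine_mx M -> affine_mx (- M).
Proof. by move=> aM i j; rewrite mxE; apply: affineN. Qed.

Lemma affine_mx1 (a : nat) : affine_mx (1%:M : 'M[K]_a).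
Proof. by rewrite -(map_mx1 constf); apply: affine_constmx. Qed.

Lemma affine_pencil (N : nat) (M : 'M[K]_N) :
  affine_mx M -> exists A : 'I_n.+1 -> 'M[C]_N, M = pencil A.
Proof.
move=> aM.
have [F FP] : exists F : 'I_N -> 'I_N -> 'I_n.+1 -> C, forall i j, M i j =
    tofrac (mpolyC n (F i j ord0) + \sum_(l < n) 'X_l * mpolyC n (F i j (lift ord0 l))).
  apply: (@fin_all_exists _ _ (fun i F => forall j, M i j =
    tofrac (mpolyC n (F j ord0)
      + \sum_(l < n) 'X_l * mpolyC n (F j (lift ord0 l))))) => i.
  apply: (@fin_all_exists _ _ (fun j F => M i j =
    tofrac (mpolyC n (F ord0) + \sum_(l < n) 'X_l * mpolyC n (F (lift ord0 l))))) => j.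
  exact: aM.
exists (fun l => \matrix_(i, j) F i j l); apply/matrixP => i j.
rewrite FP !mxE !summxE; congr (tofrac (_ + _)).
by apply: eq_bigr => l _; rewrite !mxE.
Qed.

(* u and v are constant so that the block v u' coupling the two pencils of a
   product u D^-1 v u' D'^-1 v' is constant as well. *)
Definition realizable (a b : nat) (M : 'M[K]_(a, b)) :=
  exists (m : nat) (u : 'M[C]_(a, m)) (D E : 'M[K]_m) (v : 'M[C]_(m, b)),
    [/\ affine_mx D, D *m E = 1%:M & M = map_mx constf u *m E *m map_mx constf v].

(** Since [u] and [v] must be constant, [M] is placed in a unipotent block matrix; the inverse has
    [M] in its upper right block, which [u] and [v] extract. *)
Lemma realizable_affine (a b : nat) (M : 'M[K]_(a, b)) : affine_mx M -> realizable M.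
Proof.
move=> aM; exists (a + b)%N, (row_mx 1%:M 0), (block_mx 1%:M (- M) 0 1%:M),
  (block_mx 1%:M M 0 1%:M), (col_mx 0 1%:M); split.
- apply: affine_block; [exact: affine_mx1 | exact: affine_mxN | |].
    exact: affine_mx0.
  exact: affine_mx1.
- rewrite mulmx_block !mul1mx !mulmx1 !mul0mx !mulmx0 !(addr0, add0r) subrr.
  by rewrite -scalar_mx_block.
rewrite map_row_mx map_col_mx !map_mx0 !map_mx1 mul_row_block mul_row_col.
by rewrite !(mul0mx, mul1mx, mulmx0, mulmx1, addr0, add0r).
Qed.

Lemma realizableD (a b : nat) (M N : 'M[K]_(a, b)) :
  realizable M -> realizable N -> realizable (M + N).
Proof.
move=> [m [u [D [E [v [aD DE ->]]]]]] [m' [u' [D' [E' [v' [aD' DE' ->]]]]]].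
exists (m + m')%N, (row_mx u u'), (block_mx D 0 0 D'), (block_mx E 0 0 E'),
  (col_mx v v'); split.
- by apply: affine_block => //; apply: affine_mx0.
- by rewrite mulmx_block DE DE' !(mul0mx, mulmx0, addr0, add0r) -scalar_mx_block.
rewrite map_row_mx map_col_mx mul_row_block mul_row_col.
by rewrite !(mulmx0, addr0, add0r).
Qed.

(** The inverse of a block triangular matrix with diagonal blocks [D], [D'] and corner [- w] has
    [E *m w *m E'] in that corner. *)
Lemma realizableM (a b c : nat) (M : 'M[K]_(a, b)) (N : 'M[K]_(b, c)) :
  realizable M -> realizable N -> realizable (M *m N).
Proof.
move=> [m [u [D [E [v [aD DE ->]]]]]] [m' [u' [D' [E' [v' [aD' DE' ->]]]]]].
pose w := map_mx constf v *m map_mx constf u'.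
exists (m + m')%N, (row_mx u 0), (block_mx D (- w) 0 D'),
  (block_mx E (E *m w *m E') 0 E'), (col_mx 0 v'); split.
- apply: affine_block => //; last exact: affine_mx0.
  by rewrite /w -map_mxM; apply/affine_mxN/affine_constmx.
- rewrite mulmx_block DE DE' -/w !(mulmxA D) DE mul1mx !mulNmx addrN.
  by rewrite !(mul0mx, mulmx0, addr0, add0r, oppr0) -scalar_mx_block.
rewrite map_row_mx map_col_mx !map_mx0 mul_row_block mul_row_col.
by rewrite !(mul0mx, mulmx0, addr0, add0r) !mulmxA.
Qed.

(** Bordering [D] by [U], [V] and a zero corner gives a matrix in which the Schur complement of [D]
    is [- x]. Its inverse therefore has the corner [- x^-1], and the row vector [u] restores the
    sign. *)
Lemma realizableV (x : K) :
  realizable (x%:M : 'M_1) -> x != 0 -> realizable (x^-1%:M : 'M_1).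
Proof.
move=> [m [u [D [E [v [aD DE xE]]]]]] x0; pose y : 'M[K]_1 := x^-1%:M.
pose U := map_mx constf u; pose V := map_mx constf v.
have xy : U *m E *m V *m y = 1%:M by rewrite -xE -scalar_mxM divff.
exists (1 + m)%N, (row_mx (- 1%:M) 0), (block_mx 0 U V D),
  (block_mx (- y) (y *m U *m E) (E *m V *m y) (E - E *m V *m y *m U *m E)),
  (col_mx 1%:M 0); split.
- apply: affine_block => //; [exact: affine_mx0 | |]; exact: affine_constmx.
- rewrite mulmx_block !mul0mx !add0r mulmxN !mulmxBr !mulmxA xy DE !mul1mx subrr.
  by rewrite addNr addrCA subrr addr0 -scalar_mx_block.
rewrite map_row_mx map_col_mx map_mxN !map_mx0 !map_mx1 mul_row_block mul_row_col.
by rewrite !(mul0mx, mulmx0, addr0, add0r) mulmx1 mulNmx mul1mx opprK.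
Qed.

Lemma realizable_scalar (x : K) : realizable (x%:M : 'M_1).
Proof.
have rC c : realizable ((constf c)%:M : 'M_1).
  by rewrite -map_scalar_mx; apply/realizable_affine/affine_constmx.
have rX i : realizable ((tofrac 'X_i)%:M : 'M[K]_1).
  apply: realizable_affine => r s; rewrite mxE !ord1 eqxx; exact: affineX.
have rM y y' : realizable (y%:M : 'M[K]_1) -> realizable (y'%:M : 'M_1) ->
  realizable ((y * y')%:M : 'M_1) by rewrite scalar_mxM; apply: realizableM.
have r1 : realizable (1%:M : 'M[K]_1) by rewrite -(rmorph1 constf).
have rp p : realizable ((tofrac p)%:M : 'M[K]_1).
  elim/mpolyind: p => [|c m p _ _ IHp]; first by rewrite tofrac0 -(rmorph0 constf).
  rewrite tofracD raddfD; apply: realizableD => //.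
  rewrite -mul_mpolyC tofracM; apply: (rM); first exact: rC.
  rewrite mpolyXE_id rmorph_prod.
  apply: (big_ind (fun y => realizable (y%:M : 'M[K]_1))) => [//||i _]; first exact: rM.
  by rewrite /= tofracXn; elim: (m i) => [|l IHl]; rewrite ?expr0 // exprS; apply: (rM).
have [p [q [q0 ->]]] := fraction_ratio x; apply: rM => //.
by apply: realizableV => //; rewrite tofrac_eq0.
Qed.

Lemma realizable_all (a b : nat) (M : 'M[K]_(a, b)) : realizable M.
Proof.
have r0 : realizable (0 : 'M[K]_(a, b)).
  by apply/realizable_affine/affine_mx0.
rewrite [M]matrix_sum_delta.
apply: (big_ind (@realizable a b)) => [//||i _]; first exact: realizableD.
apply: (big_ind (@realizable a b)) => [//||j _]; first exact: realizableD.
(* Each matrix unit factors through dimension one, with the scalar entry in the middle. *)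
have -> : M i j *: delta_mx i j = map_mx constf (delta_mx i 0) *m
    (M i j)%:M *m map_mx constf (delta_mx (0 : 'I_1) j) :> 'M[K]_(a, b).
  by rewrite !map_delta_mx mul_mx_scalar -scalemxAl mul_delta_mx.
by apply: realizableM; [apply: realizableM; [|exact: realizable_scalar] |];
  apply/realizable_affine/affine_constmx.
Qed.

Lemma schur_rep_exists (k : nat) (f : 'M[K]_k) :
  exists (m : nat) (A : 'I_n.+1 -> 'M[C]_(k + m)), schur_rep f A.
Proof.
have [m [u [D [E [v [aD DE fE]]]]]] := realizable_all f.
(* The sign on [v] cancels the minus sign of the Schur complement. *)
have [A AE] : exists A : 'I_n.+1 -> 'M[C]_(k + m),
    block_mx 0 (map_mx constf u) (map_mx constf (- v)) D = pencil A.
  apply/affine_pencil/affine_block => //; [exact: affine_mx0 | |]; exact: affine_constmx.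
have [uD _] := mulmx1_unit DE; exists m, A; split.
  by rewrite -AE block_mxKdr -unitfE -unitmxE.
rewrite -AE /schur_complement block_mxKul block_mxKur block_mxKdl block_mxKdr.
by rewrite map_mxN mulmxN sub0r opprK fE -[E](mulKmx uD) DE mulmx1.
Qed.

End Realization.

(** * Functional relations *)

Section Relations.

Variables (C : numClosedFieldType) (n k m : nat).
Implicit Types (z : 'I_n -> C) (f : 'M[ratfun C n]_k).
Implicit Types (A B : 'I_n.+1 -> 'M[C]_(k + m)).

(** The conjugate pencil at [z] is the conjugate of the pencil at the conjugate point, so its Schur
    complement is the conjugate of a value of [f] there, which the invariance identifies with the
    value at [z]. *)
Lemma schur_rep_conj f A :
  conj_invariant f -> schur_rep f A -> schur_rep f (fun j => conj_mx (A j)).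
Proof.
move=> cf /schur_repP fA; apply/schur_repP.
have := generic_and (generic_mxvalue f) (generic_twist (@twist_conj C n) fA).
apply: generic_imp => z [[V fV] [Az fz]]; rewrite pencil_at_conj.
rewrite /conj_mx -map_drsubmx det_map_mx fmorph_eq0; split=> //.
by rewrite schur_complement_map -[map_mx _ _]/(conj_mx _) -(cf _ _ _ fV fz).
Qed.

Lemma schur_rep_tr f A :
  f = f^T -> schur_rep f A -> schur_rep f (fun j => (A j)^T).
Proof.
move=> sf /schur_repP fA; apply/schur_repP; apply: generic_imp fA => z [Az fz].
rewrite pencil_at_tr -trmx_drsub det_tr schur_complement_tr; split=> // i j.
by rewrite sf mxE [X in value_at _ _ X]mxE; apply: fz.
Qed.

Lemma schur_rep_adjoint f A : adjoint_invariant f ->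
  schur_rep f A -> schur_rep f (fun j => adjoint_mx (A j)).
Proof.
move=> cf /schur_repP fA; apply/schur_repP.
have := generic_and (generic_mxvalue f) (generic_twist (@twist_conj C n) fA).
apply: generic_imp => z [[V fV] [Az fz]].
rewrite (pencil_at_tr (fun j => conj_mx (A j))) pencil_at_conj.
rewrite -trmx_drsub det_tr schur_complement_tr.
rewrite /conj_mx -map_drsubmx det_map_mx fmorph_eq0; split=> //.
by rewrite schur_complement_map -[_^T]/(adjoint_mx _) -(cf _ _ _ fV fz).
Qed.

Lemma real_rep_conj_invariant f A :
  schur_rep f A -> (forall j, A j = conj_mx (A j)) -> conj_invariant f.
Proof.
move=> fA rA z V W fV fW; apply/matrixP => i j; rewrite !mxE -[RHS]mul1r.
apply: (value_at_twist (@twist_conj C n)) (fV i j) (fW i j).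
have := generic_and (generic_twist (@twist_conj C n) (proj1 (schur_repP f A) fA))
  (proj1 (schur_repP f A) fA).
apply: generic_imp => x [[_ fx'] [_ fx]].
do 2!eexists; split; [exact: fx | exact: fx' |].
by rewrite (pencil_at_ext x rA) pencil_at_conj schur_complement_map mul1r !mxE.
Qed.

Lemma symmetric_rep_tr f A :
  schur_rep f A -> (forall j, A j = (A j)^T) -> f = f^T.
Proof.
move=> fA sA; apply: mx_eq_generic; move/schur_repP: fA.
apply: generic_imp => z [_ fz]; eexists; split; first exact: fz.
rewrite (pencil_at_ext z sA) pencil_at_tr schur_complement_tr => i j.
by rewrite [X in value_at X]mxE [X in value_at _ _ X]mxE; apply: fz.
Qed.

Lemma hermitian_rep_adjoint_invariant f A :
  schur_rep f A -> (forall j, A j = adjoint_mx (A j)) -> adjoint_invariant f.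
Proof.
move=> fA rA z V W fV fW; apply/matrixP => i j; rewrite !mxE -[RHS]mul1r.
apply: (value_at_twist (@twist_conj C n)) (fV i j) (fW j i).
have := generic_and (generic_twist (@twist_conj C n) (proj1 (schur_repP f A) fA))
  (proj1 (schur_repP f A) fA).
apply: generic_imp => x [[_ fx'] [_ fx]].
do 2!eexists; split; [exact: fx | exact: fx' |].
rewrite (pencil_at_ext x rA) (pencil_at_tr (fun j => conj_mx (A j))).
by rewrite pencil_at_conj schur_complement_tr schur_complement_map mul1r !mxE.
Qed.

Lemma pencil_at_scale A z (a : C) : A ord0 = 0 ->
  pencil_at A (fun i => a * z i) = a *: pencil_at A z.
Proof.
move=> A0; rewrite /pencil_at A0 !add0r scaler_sumr.
by apply: eq_bigr => i _; rewrite scalerA.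
Qed.

Lemma homogeneous_rep f A :
  schur_rep f A -> A ord0 = 0 -> homogeneous_deg1 f.
Proof.
move=> fA A0.
have nz (a : C) z V W : a != 0 -> mxvalue_at f (fun i => a * z i) V ->
    mxvalue_at f z W -> V = a *: W.
  (* [value_at_twist] puts the scalar next to the value at the twisted point, so the relation is
     proved as [W = a^-1 *: V]. *)
  move=> a0 fV fW; apply: (scalerI (invr_neq0 a0)); rewrite scalerA mulVf // scale1r.
  apply/esym/matrixP => i j; rewrite [RHS]mxE.
  apply: (value_at_twist (rho := idfun) (twist_scale (n := n) a0) _ (fW i j) (fV i j)).
  have := generic_and (generic_twist (rho := idfun) (twist_scale (n := n) a0)
    (proj1 (schur_repP f A) fA)) (proj1 (schur_repP f A) fA).
  apply: generic_imp => x [[_ fx'] [Ax fx]].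
  do 2!eexists; split; [exact: fx | exact: fx' |].
  rewrite pencil_at_scale // schur_complementZ // -[LHS](mulKf a0); congr (_ * _).
  by rewrite /= [RHS]mxE.
move=> a z V W fV fW; have [a0|] := eqVneq a 0; last by move/nz; apply.
rewrite a0 scale0r.
(* V is a value at the origin, which is fixed by the dilation of ratio 2. *)
have fV2 : mxvalue_at f (fun i => 2 * (a * z i)) V.
  by move=> i j; apply: value_at_ext (fV i j) => l; rewrite a0 mul0r mulr0.
have : V = 2 *: V by apply: nz fV2 fV; rewrite pnatr_eq0.
by rewrite scaler_nat mulr2n -{1}[V]addr0 => /addrI.
Qed.

(** The pencil [B] is [(z l / c) *: A] evaluated at the multiple of [z] lying on the hyperplane
    where the coordinate [l] equals [c]. *)
Lemma homogenize f A (l : 'I_n) : homogeneous_deg1 f -> schur_rep f A ->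
  exists B, schur_rep f B /\ B ord0 = 0.
Proof.
move=> hf fA; have Xl0 : 'X_l != 0 :> {mpoly C[n]}.
  by rewrite -msize_poly_eq0 msizeX.
(* The constant [c] is the coordinate [l] of a point where the lower right block is invertible.
   There [B] agrees with [A], which shows that the block of [B] is invertible too. *)
have [z0 [/= ]] := generic_ex (generic_and (generic_meval Xl0)
  (generic_pencil_det (proj1 fA))).
rewrite mevalXU; set c := z0 l => c0 Az0.
pose B j := if unlift ord0 j is Some i
  then A j + (if i == l then c^-1 *: A ord0 else 0) else 0.
have BE z : pencil_at B z = (z l / c) *: A ord0 + \sum_i z i *: A (lift ord0 i).
  rewrite /pencil_at /B unlift_none add0r.
  under eq_bigr do rewrite liftK scalerDr.
  rewrite big_split addrC; congr (_ + _).
  rewrite (bigD1 l) //= eqxx scalerA big1 ?addr0 // => i /negPf ->.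
  by rewrite scaler0.
have BA z : z l != 0 ->
    pencil_at B z = (z l / c) *: pencil_at A (fun i => c / z l * z i).
  move=> zl; rewrite BE /pencil_at scalerDr scaler_sumr; congr (_ + _).
  by apply: eq_bigr => i _; rewrite scalerA mulrA mulrA divfK // divff ?mul1r.
have detB : \det (drsubmx (pencil_at B z0)) != 0.
  by rewrite BE divff // scale1r.
exists B; split; last by rewrite /B unlift_none.
apply/schur_repP; have := generic_and (generic_and (generic_meval Xl0)
  (generic_mxvalue f)) (generic_pencil_det (pencil_det_neq0 detB)).
apply: generic_imp => z [[]]; rewrite mevalXU => zl [V fV] Bz; split=> //.
have zc : z l / c != 0 by rewrite mulf_neq0 ?invr_eq0.
have Az : \det (drsubmx (pencil_at A (fun i => c / z l * z i))) != 0.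
  move: Bz; rewrite BA //; set M := pencil_at A _.
  have -> : drsubmx (z l / c *: M) = z l / c *: drsubmx M.
    by apply/matrixP => i j; rewrite !mxE.
  by rewrite detZ mulf_eq0 => /norP[].
(* The factor [z l / c] from the Schur complement cancels the factor [c / z l] from the homogeneity
   of [f]. *)
rewrite BA // schur_complementZ // (hf _ _ _ _ (schur_rep_value fA Az) fV).
by rewrite scalerA mulrA divfK // divff // scale1r.
Qed.

End Relations.

(** * Symmetrization *)

Section Average.

Variables (F : fieldType) (k m : nat).
Implicit Types (S T : 'M[F]_(m + m)) (X Y : 'M[F]_(k + m)).

(* The invertible S and T are a change of basis of the auxiliary space, chosen
   later so that the doubled pencil is symmetric, Hermitian or real. *)
Definition avg_pencil S T X Y : 'M[F]_(k + (m + m)) :=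
  block_mx (2^-1 *: (ulsubmx X + ulsubmx Y))
           (row_mx (ursubmx X) (ursubmx Y) *m S)
           (T *m col_mx (dlsubmx X) (dlsubmx Y))
           (T *m block_mx (2 *: drsubmx X) 0 0 (2 *: drsubmx Y) *m S).

Definition swap_mx : 'M[F]_(m + m) := block_mx 0 1%:M 1%:M 0.

Lemma swap_mxK : swap_mx *m swap_mx = 1%:M.
Proof.
by rewrite mulmx_block !mulmx1 !mulmx0 ?(addr0, add0r) -scalar_mx_block.
Qed.

Lemma swap_mx_tr : swap_mx^T = swap_mx.
Proof. by rewrite tr_block_mx !trmx0 trmx1. Qed.

Lemma avg_pencil_tr S T X Y :
  (avg_pencil S T X Y)^T = avg_pencil T^T S^T X^T Y^T.
Proof.
rewrite tr_block_mx !trmx_mul tr_row_mx tr_col_mx tr_block_mx !trmx0 mulmxA.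
rewrite !linearZ linearD /=.
by rewrite !trmx_ulsub !trmx_ursub !trmx_dlsub !trmx_drsub.
Qed.

(** Exchanging [X] and [Y] only permutes the two halves of the auxiliary space, so it is absorbed by
    [S] and [T]. *)
Lemma avg_pencil_swap S T X Y :
  avg_pencil S T X Y = avg_pencil (swap_mx *m S) (T *m swap_mx) Y X.
Proof.
rewrite /avg_pencil addrC; congr block_mx.
- by rewrite mulmxA mul_row_block !mulmx0 !mulmx1 addr0 add0r.
- by rewrite -mulmxA mul_block_col !mul0mx !mul1mx addr0 add0r.
- rewrite -!mulmxA; congr (_ *m _); rewrite !mulmxA; congr (_ *m _).
  by rewrite !mulmx_block ?(mulmx0, mul0mx, mulmx1, mul1mx, addr0, add0r).
Qed.

(** With [S] and [T] constant, the construction can thus be applied coefficient by coefficient to a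
    pencil. *)
Lemma avg_pencil_linear S T (a : F) X X' Y Y' :
  avg_pencil S T (a *: X + X') (a *: Y + Y') =
  a *: avg_pencil S T X Y + avg_pencil S T X' Y'.
Proof.
have subE (M N : 'M[F]_(k + m)) : [/\ ulsubmx (a *: M + N) = a *: ulsubmx M + ulsubmx N,
    ursubmx (a *: M + N) = a *: ursubmx M + ursubmx N,
    dlsubmx (a *: M + N) = a *: dlsubmx M + dlsubmx N
  & drsubmx (a *: M + N) = a *: drsubmx M + drsubmx N].
  by split; apply/matrixP => i j; rewrite !mxE.
rewrite /avg_pencil; have [-> -> -> ->] := subE X X'; have [-> -> -> ->] := subE Y Y'.
rewrite scale_block_mx add_block_mx; congr block_mx.
- by rewrite addrACA !scalerDr !scalerA mulrC.
- by rewrite scalemxAl scale_row_mx -mulmxDl add_row_mx.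
- by rewrite scalemxAr scale_col_mx -mulmxDr add_col_mx.
rewrite scalemxAl scalemxAr -mulmxDl -mulmxDr scale_block_mx add_block_mx.
by rewrite !scaler0 !addr0 !scalerDr !scalerA mulrC.
Qed.

Lemma schur_avg_pencil S T X Y : (2 : F) != 0 ->
  S \in unitmx -> T \in unitmx ->
  drsubmx X \in unitmx -> drsubmx Y \in unitmx ->
  drsubmx (avg_pencil S T X Y) \in unitmx /\
  schur_complement (avg_pencil S T X Y) =
    2^-1 *: (schur_complement X + schur_complement Y).
Proof.
move=> two0 uS uT uX uY.
rewrite /schur_complement /avg_pencil block_mxKul block_mxKur block_mxKdl block_mxKdr.
set D := block_mx _ _ _ _.
(* The doubled diagonal blocks of [D] put a factor [2^-1] on each inverse, which yields the average;
   [S] and [T] cancel against their inverses. *)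
pose E := block_mx (2^-1 *: invmx (drsubmx X)) 0 0 (2^-1 *: invmx (drsubmx Y)).
have DE : D *m E = 1%:M.
  rewrite mulmx_block !mulmx0 !mul0mx !addr0 !add0r -!scalemxAl -!scalemxAr.
  by rewrite !mulmxV // !scalerA divff // !scale1r -scalar_mx_block.
have [uD uE] := mulmx1_unit DE.
have uTDS : T *m D *m S \in unitmx by rewrite !unitmx_mul uT uD.
split=> //.
have -> : invmx (T *m D *m S) = invmx S *m E *m invmx T.
  rewrite -[LHS]mulmx1 -[RHS](mulKmx uTDS); congr (_ *m _).
  rewrite !mulmxA mulmxK //.
  by rewrite -(mulmxA _ D) DE mulmx1 mulmxV.
rewrite !mulmxA mulmxK // mulmxKV //.
rewrite mul_row_block mul_row_col !mulmx0 !addr0 !add0r -!scalemxAr -!scalemxAl.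
by rewrite -!scalerDr -scalerBr opprD addrACA.
Qed.

End Average.

Section Symmetrize.

Variables (C : numClosedFieldType) (n k m : nat).
Implicit Types (f : 'M[ratfun C n]_k) (A B : 'I_n.+1 -> 'M[C]_(k + m)).
Implicit Types (S T : 'M[C]_(m + m)).

Lemma pencil_at_avg S T A B z :
  pencil_at (fun j => avg_pencil S T (A j) (B j)) z =
  avg_pencil S T (pencil_at A z) (pencil_at B z).
Proof.
(* The constant coefficients are moved last so that they form the base case of the induction over
   the sums. *)
rewrite /pencil_at (addrC (A ord0)) (addrC (B ord0)) (addrC (avg_pencil _ _ _ _)).
elim/big_rec3: _ => [|i X Y M _ IH]; first by rewrite !add0r.
by rewrite -!addrA avg_pencil_linear -IH addrA.
Qed.

Lemma schur_rep_avg f A B S T : S \in unitmx -> T \in unitmx ->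
  schur_rep f A -> schur_rep f B ->
  schur_rep f (fun j => avg_pencil S T (A j) (B j)).
Proof.
move=> uS uT /schur_repP fA /schur_repP fB; apply/schur_repP.
apply: generic_imp (generic_and fA fB) => z [[Az fAz] [Bz fBz]].
have two0 : (2 : C) != 0 by rewrite pnatr_eq0.
have [] := schur_avg_pencil two0 uS uT (X := pencil_at A z) (Y := pencil_at B z).
- by rewrite unitmxE unitfE.
- by rewrite unitmxE unitfE.
rewrite pencil_at_avg unitmxE unitfE => -> ->; split=> //.
rewrite (mxvalue_at_uniq fBz fAz) -mulr2n -scaler_nat scalerA mulVf //.
by rewrite scale1r.
Qed.

Lemma avg_pencil0 S T : avg_pencil S T 0 0 = 0 :> 'M[C]_(k + (m + m)).
Proof.
have := avg_pencil_linear S T (-1) (0 : 'M[C]_(k + m)) 0 0 0.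
by rewrite !scaler0 !addr0 scaleN1r addNr.
Qed.

Lemma conj_avg_pencil S T (X Y : 'M[C]_(k + m)) :
  conj_mx (avg_pencil S T X Y) =
  avg_pencil (conj_mx S) (conj_mx T) (conj_mx X) (conj_mx Y).
Proof.
rewrite /conj_mx map_block_mx !map_mxM !map_mxZ map_mxD map_row_mx map_col_mx.
rewrite map_block_mx !map_mx0 !map_mxZ fmorphV rmorph_nat.
by rewrite !map_ulsubmx !map_ursubmx !map_dlsubmx !map_drsubmx.
Qed.

Lemma conj_mxK (a b : nat) (X : 'M[C]_(a, b)) : conj_mx (conj_mx X) = X.
Proof. by apply/matrixP => i j; rewrite !mxE conjCK. Qed.

Lemma conj_mx_tr (a b : nat) (X : 'M[C]_(a, b)) : conj_mx X^T = (conj_mx X)^T.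
Proof. by apply/matrixP => i j; rewrite !mxE. Qed.

Lemma unit_swap_mx : swap_mx C m \in unitmx.
Proof. by have [] := mulmx1_unit (swap_mxK C m). Qed.

(** Transposition exchanges [A] with its transpose and [S] with [T]. Swapping the two halves back
    returns the pair [swap_mx], [1%:M], because [swap_mx] is a symmetric involution. *)
Lemma symmetrize f A : f = f^T -> schur_rep f A ->
  exists B : 'I_n.+1 -> 'M[C]_(k + (m + m)),
    [/\ schur_rep f B, forall j, B j = (B j)^T & A ord0 = 0 -> B ord0 = 0].
Proof.
move=> sf fA; exists (fun j => avg_pencil (swap_mx C m) 1%:M (A j) (A j)^T).
split=> [|j|->]; last by rewrite trmx0 avg_pencil0.
  by apply: schur_rep_avg (unit_swap_mx) (unitmx1 _ _) fA (schur_rep_tr sf fA).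
rewrite avg_pencil_tr trmx1 swap_mx_tr trmxK [RHS]avg_pencil_swap.
by rewrite mulmx1 swap_mxK.
Qed.

(** The argument for symmetric pencils applies with the adjoint in place of the transpose, since
    [swap_mx] is also real. *)
Lemma hermitize f A : adjoint_invariant f -> schur_rep f A ->
  exists B : 'I_n.+1 -> 'M[C]_(k + (m + m)),
    [/\ schur_rep f B, forall j, B j = adjoint_mx (B j) & A ord0 = 0 -> B ord0 = 0].
Proof.
move=> af fA; exists (fun j => avg_pencil (swap_mx C m) 1%:M (A j) (adjoint_mx (A j))).
split=> [|j|->]; last by rewrite /adjoint_mx /conj_mx map_mx0 trmx0 avg_pencil0.
  by apply: schur_rep_avg (unit_swap_mx) (unitmx1 _ _) fA (schur_rep_adjoint af fA).
rewrite /adjoint_mx conj_avg_pencil avg_pencil_tr conj_mx_tr trmxK conj_mxK.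
rewrite [RHS]avg_pencil_swap {2 3}/conj_mx map_mx1 trmx1 map_block_mx !map_mx0 !map_mx1.
by rewrite swap_mx_tr mulmx1 swap_mxK.
Qed.

(* For a block X with conjugate Y, the matrix [X Y] S is real.  Taking T = S^T
   on the other side keeps a symmetric pencil symmetric. *)
Definition real_mx : 'M[C]_(m + m) := block_mx 1%:M ('i%:M) 1%:M (- 'i)%:M.

Lemma unit_real_mx : real_mx \in unitmx.
Proof.
(* The product of [real_mx] and its transpose is twice [swap_mx]. *)
have : real_mx *m (2^-1 *: (real_mx^T *m swap_mx C m)) = 1%:M.
  rewrite -scalemxAr mulmxA tr_block_mx !tr_scalar_mx !mulmx_block.
  rewrite !(mulmx1, mul1mx, mulmx0, mul0mx, addr0, add0r) -!scalar_mxM.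
  rewrite !(mulrN, mulNr) -expr2 sqrCi !opprK -!raddfD /= subrr raddf0.
  by rewrite scale_block_mx !scaler0 scale_scalar_mx mulVf ?pnatr_eq0 // -scalar_mx_block.
by case/mulmx1_unit.
Qed.

(** Conjugation exchanges the two block rows of [real_mx]. *)
Lemma swap_conj_real_mx : swap_mx C m *m conj_mx real_mx = real_mx.
Proof.
rewrite /conj_mx map_block_mx !map_scalar_mx mulmx_block rmorph1 rmorphN /= conjCi opprK.
by rewrite !mul1mx !mul0mx !add0r !addr0.
Qed.

(** Conjugation exchanges [A] with its conjugate and also the block rows of [real_mx]; the two
    exchanges cancel. *)
Lemma realify f A : conj_invariant f -> schur_rep f A ->
  exists B : 'I_n.+1 -> 'M[C]_(k + (m + m)),
    [/\ schur_rep f B, forall j, B j = conj_mx (B j),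
        (forall j, A j = (A j)^T) -> forall j, B j = (B j)^T
      & A ord0 = 0 -> B ord0 = 0].
Proof.
move=> cf fA; exists (fun j => avg_pencil real_mx real_mx^T (A j) (conj_mx (A j))).
split=> [|j|sA j|->]; last by rewrite /conj_mx map_mx0 avg_pencil0.
- apply: schur_rep_avg fA (schur_rep_conj cf fA); first exact: unit_real_mx.
  by rewrite unitmx_tr unit_real_mx.
- rewrite conj_avg_pencil conj_mxK [RHS]avg_pencil_swap swap_conj_real_mx.
  by rewrite -[X in _ *m X]swap_mx_tr conj_mx_tr -trmx_mul swap_conj_real_mx.
by rewrite avg_pencil_tr trmxK -conj_mx_tr -sA.
Qed.

End Symmetrize.

(** * Combinations of the properties *)

Lemma conj_adjoint_tr (C : numClosedFieldType) (n k : nat) (f : 'M[ratfun C n]_k) :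
  conj_invariant f -> adjoint_invariant f -> f = f^T.
Proof.
move=> cf af; apply: mx_eq_generic.
have gf := generic_mxvalue f; have := generic_and gf (generic_twist (@twist_conj C n) gf).
apply: generic_imp => z [[V fV] [W fW]]; exists V; split=> // i j.
(* Both relations compare [V] with the same [W]: it is the conjugate of [W] and the transpose of
   that conjugate. *)
have VT : V = V^T by rewrite {1}(af _ _ _ fV fW) /adjoint_mx -(cf _ _ _ fV fW).
by rewrite mxE VT mxE.
Qed.

Lemma tr_adjoint_conj (C : numClosedFieldType) (n k : nat) (f : 'M[ratfun C n]_k) :
  f = f^T -> adjoint_invariant f -> conj_invariant f.
Proof.
move=> sf af z V W fV fW; rewrite (af _ _ _ fV fW) /adjoint_mx -conj_mx_tr.
congr conj_mx; apply: (mxvalue_at_uniq _ fW) => i j.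
by rewrite sf !mxE.
Qed.

(** The pencil is homogenized first, and each later construction preserves what was achieved before.
    The Hermitian construction is applied directly only when neither reality nor symmetry is
    required; otherwise the Hermitian property comes from symmetry and reality. *)
Lemma schur_rep_choose (C : numClosedFieldType) (n k : nat) (n_gt0 : (0 < n)%N)
    (f : 'M[ratfun C n]_k) (a b c d : bool) :
  [/\ a -> homogeneous_deg1 f, b -> conj_invariant f, c -> f = f^T
    & d -> adjoint_invariant f] <->
  exists (m : nat) (A : 'I_n.+1 -> 'M[C]_(k + m)),
    schur_rep f A /\
    [/\ a -> A ord0 = 0, b -> forall j, A j = conj_mx (A j),
        c -> forall j, A j = (A j)^T & d -> forall j, A j = adjoint_mx (A j)].
Proof.
split=> [[fa fb fc fd]|[m [A [fA [Aa Ab Ac Ad]]]]]; last first.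
  split=> [/Aa|/Ab|/Ac|/Ad].
  - exact: homogeneous_rep fA.
  - exact: real_rep_conj_invariant fA.
  - exact: symmetric_rep_tr fA.
  - exact: hermitian_rep_adjoint_invariant fA.
have [m [A [fA Aa]]] : exists m (A : 'I_n.+1 -> 'M[C]_(k + m)),
    schur_rep f A /\ (a -> A ord0 = 0).
  have [m [A fA]] := schur_rep_exists f; exists m.
  case: a fa => [/(_ isT) hf|_]; last by exists A.
  by have [B [fB B0]] := homogenize (Ordinal n_gt0) hf fA; exists B.
have [/and3P[d1 /negPf b0 /negPf c0]|dbc] := boolP [&& d, ~~ b & ~~ c].
  have [B [fB hB B0]] := hermitize (fd d1) fA.
  by exists (m + m)%N, B; split=> //; split; rewrite ?b0 ?c0 // => /Aa.
(* The conditions [b || c && d] and [c || b && d] complete the requested symmetries by the one that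
   two of them imply. *)
have cf : b || c && d -> conj_invariant f.
  by case/orP => [//|/andP[/fc sf /fd]]; apply: tr_adjoint_conj.
have sf : c || b && d -> f = f^T.
  by case/orP => [//|/andP[/fb + /fd]]; apply: conj_adjoint_tr.
have [m1 [A1 [fA1 A1a sA1]]] : exists m (A : 'I_n.+1 -> 'M[C]_(k + m)),
    [/\ schur_rep f A, a -> A ord0 = 0 & c || b && d -> forall j, A j = (A j)^T].
  case: (boolP (c || b && d)) => [/sf fT|_]; last by exists m, A.
  have [B [fB sB B0]] := symmetrize fT fA.
  by exists (m + m)%N, B; split=> // /Aa.
have [m2 [A2 [fA2 A2a sA2 rA2]]] : exists m (A : 'I_n.+1 -> 'M[C]_(k + m)),
    [/\ schur_rep f A, a -> A ord0 = 0, c || b && d -> forall j, A j = (A j)^T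
      & b || c && d -> forall j, A j = conj_mx (A j)].
  case: (boolP (b || c && d)) => [/cf fC|_]; last by exists m1, A1.
  have [B [fB rB sB B0]] := realify fC fA1.
  by exists (m1 + m1)%N, B; split=> // [/A1a|/sA1].
exists m2, A2; split=> //; split=> // [b1|c1|d1 j].
- by apply: rA2; rewrite b1.
- by apply: sA2; rewrite c1.
(* With [d] and at least one of [b] and [c], the pencil has been made both real and symmetric, hence
   Hermitian. *)
have [b1 c1] : b || c && d /\ c || b && d
  by move: dbc; rewrite d1; clear; case: b; case: c.
by rewrite {1}rA2 // /adjoint_mx -conj_mx_tr -sA2.
Qed.

Theorem theorem2 (R : realType) (k n : nat) (k_gt0 : (0 < k)%N)
    (n_gt0 : (0 < n)%N) (f : 'M[ratfun R[i] n]_k) :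
  (exists (m : nat) (A : 'I_n.+1 -> 'M[R[i]]_(k + m)), schur_rep f A)
  /\
  (* (a) *)
  (homogeneous_deg1 f <->
   exists (m : nat) (A : 'I_n.+1 -> 'M[R[i]]_(k + m)),
     schur_rep f A /\ A ord0 = 0)
  /\
  (* (b) *)
  (conj_invariant f <->
   exists (m : nat) (A : 'I_n.+1 -> 'M[R[i]]_(k + m)),
     schur_rep f A /\ forall j, A j = conj_mx (A j))
  /\
  (* (c) *)
  (f = f^T <->
   exists (m : nat) (A : 'I_n.+1 -> 'M[R[i]]_(k + m)),
     schur_rep f A /\ forall j, A j = (A j)^T)
  /\
  (* (d) *)
  (adjoint_invariant f <->
   exists (m : nat) (A : 'I_n.+1 -> 'M[R[i]]_(k + m)),
     schur_rep f A /\ forall j, A j = adjoint_mx (A j))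
  /\
  (* (e): the booleans select the combination *)
  (forall a b c d : bool,
    [/\ a -> homogeneous_deg1 f,
        b -> conj_invariant f,
        c -> f = f^T
      & d -> adjoint_invariant f]
    <->
    exists (m : nat) (A : 'I_n.+1 -> 'M[R[i]]_(k + m)),
      schur_rep f A /\
      [/\ a -> A ord0 = 0,
          b -> forall j, A j = conj_mx (A j),
          c -> forall j, A j = (A j)^T
        & d -> forall j, A j = adjoint_mx (A j)]).
Proof.
have E := schur_rep_choose n_gt0 f; split; first exact: schur_rep_exists.
split; [|split; [|split; [|split]]] => //.
(* The existence halves of the four single properties are the combinations with exactly one boolean
   true. *)
- split=> [h|[m [A [fA A0]]]]; last exact: homogeneous_rep fA A0.
  have [|m [A [fA [A0 _ _ _]]]] := proj1 (E true false false false).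
    by split.
  by exists m, A; split=> //; apply: A0.
- split=> [h|[m [A [fA rA]]]]; last exact: real_rep_conj_invariant fA rA.
  have [|m [A [fA [_ rA _ _]]]] := proj1 (E false true false false).
    by split.
  by exists m, A; split=> //; apply: rA.
- split=> [h|[m [A [fA sA]]]]; last exact: symmetric_rep_tr fA sA.
  have [|m [A [fA [_ _ sA _]]]] := proj1 (E false false true false).
    by split.
  by exists m, A; split=> //; apply: sA.
split=> [h|[m [A [fA hA]]]]; last exact: hermitian_rep_adjoint_invariant fA hA.
have [|m [A [fA [_ _ _ hA]]]] := proj1 (E false false false true).
  by split.
by exists m, A; split=> //; apply: hA.
Qed.
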